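(* For any integer $n \geq 1$ and any $\epsilon \in [0, \pi/n^2]$, there exist $2n$ qubits $(X_1, Z_1), \ldots, (X_{2n}, Z_{2n})$ in $(\mathbb{C}^2)^{\otimes (2n)}$ such that $\|[S_i, T_j]\| \leq \epsilon$ for all $i \neq j$ and all $S, T \in \{X, Z\}$, but such that for any independent qubits $(X_1', Z_1'), \ldots, (X_{2n}', Z_{2n}')$ in $(\mathbb{C}^2)^{\otimes (2n)}$ (that is, qubits with $[S_i', T_j'] = 0$ for all $i \neq j$ and $S, T \in \{X, Z\}$), $$\max_{\substack{1 \leq j \leq 2n \\ S \in \{X, Z\}}} \|S_j - S_j'\| \geq \frac{n \epsilon}{2\pi}.$$
   Context: A reflection is a Hermitian operator that squares to the identity. A qubit in a Hilbert space $\mathcal H$ is a pair $(X, Z)$ of anti-commuting reflections on $\mathcal H$, i.e. $XZ + ZX = 0$. $[A,B] = AB - BA$ and $\|\cdot\|$ is the operator norm. ''$S_i$ for $S \in \{X,Z\}$'' means $X_i$ or $Z_i$. *)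

(* Defs.v *)
From HB Require Import structures.
From mathcomp Require Import all_boot all_order all_algebra.
From mathcomp Require Import complex.
From mathcomp Require Import all_classical all_reals.
From mathcomp Require Import trigo.

Set Implicit Arguments.
Unset Strict Implicit.
Unset Printing Implicit Defensive.

Import Order.TTheory GRing.Theory Num.Theory.

Local Open Scope classical_set_scope.
Local Open Scope ring_scope.

(* [(C^2)^{(x) k}] is represented in its computational (tensor product) basis:
   vectors are ['cV[R[i]]_(2 ^ k)] and operators are ['M[R[i]]_(2 ^ k)], the
   types used for [k]-fold tensor powers in [mathcomp.real_closed.mxtens]. *)

Definition l2norm (R : realType) (d : nat) (v : 'cV[R[i]]_d) : R :=
  Num.sqrt (\sum_(i < d) ComplexField.Normc.normc (v i 0) ^+ 2).

Definition opnorm (R : realType) (d : nat) (A : 'M[R[i]]_d) : R :=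
  sup [set l2norm (A *m v) | v in [set v : 'cV[R[i]]_d | l2norm v <= 1]].

Definition commutator (R : realType) (d : nat) (A B : 'M[R[i]]_d) :
    'M[R[i]]_d :=
  A *m B - B *m A.

Definition is_reflection (R : realType) (d : nat) (A : 'M[R[i]]_d) : Prop :=
  A \is hermsymmx /\ A *m A = 1%:M.

Record qubit (R : realType) (d : nat) := Qubit {
  qubitX : 'M[R[i]]_d;
  qubitZ : 'M[R[i]]_d;
  qubitX_reflection : is_reflection qubitX;
  qubitZ_reflection : is_reflection qubitZ;
  qubit_anticommute : qubitX *m qubitZ + qubitZ *m qubitX = 0
}.

(* The label "S in {X, Z}"; [qubit_op S q] is the operator S of the qubit q. *)
Variant axis := axisX | axisZ.

Definition qubit_op (R : realType) (d : nat) (S : axis) (q : qubit R d) :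
    'M[R[i]]_d :=
  match S with axisX => qubitX q | axisZ => qubitZ q end.

Definition independent (R : realType) (d m : nat) (q : 'I_m -> qubit R d) :
    Prop :=
  forall i j : 'I_m, i != j -> forall S T : axis,
    commutator (qubit_op S (q i)) (qubit_op T (q j)) = 0.

(* max over j and S of ||S_j - S'_j||; the default value 0 of the maximum over
   j is harmless because operator norms are nonnegative. *)
Definition max_distance (R : realType) (d m : nat)
    (q q' : 'I_m -> qubit R d) : R :=
  \big[Num.max/0]_(j < m)
    Num.max (opnorm (qubit_op axisX (q j) - qubit_op axisX (q' j)))
            (opnorm (qubit_op axisZ (q j) - qubit_op axisZ (q' j))).

(* Main.v *)
(* Start from independent qubits and conjugate X_k, for n <= k < 2n, by the
   diagonal unitary exp(i (eps/4) sum_(i < n <= j) Z_i Z_j).  For i < n <= j this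
   makes [X_i, X_j] of norm |1 - e^(i eps)| <= eps and leaves all other
   commutators zero.  In the group commutator of P = prod_(i < n) X_i and
   Q = prod_(n <= j) X_j the n^2 pairs add up: on a basis vector PQ and QP differ
   by 2 sin(n^2 eps / 2) >= 2 n^2 eps / pi, as n^2 eps / 2 <= pi / 2.  Replacing
   the 4n factors of PQ and QP one at a time by commuting reflections at distance
   at most delta shows that PQ and QP differ by at most 4 n delta. *)
Require Import Defs.
From HB Require Import structures.
From mathcomp Require Import all_boot all_order all_algebra.
From mathcomp Require Import complex.
From mathcomp Require Import all_classical all_reals.
From mathcomp Require Import trigo topology normedtype derive.
From mathcomp Require Import ring lra.

Set Implicit Arguments.
Unset Strict Implicit.
Unset Printing Implicit Defensive.

Import Order.TTheory GRing.Theory Num.Theory.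
Import numFieldNormedType.Exports ComplexField.Normc.

Local Open Scope ring_scope.

(** * Estimates for the sine *)

Lemma sin_MVT (R : realType) (a b : R) : a <= b ->
  exists2 c, a <= c <= b & sin b - sin a = cos c * (b - a).
Proof.
move=> ab; have [|c] := MVT_segment (f := sin) (df := cos) ab.
- by apply: continuous_subspaceT => y; exact: continuous_sin.
- by rewrite in_itv => cab eq; exists c.
Qed.

Lemma ler_norm_sin (R : realType) (x : R) : `|sin x| <= `|x|.
Proof.
wlog x0 : x / 0 <= x => [hw|].
  have [/hw //|/ltW x0] := leP 0 x.
  by rewrite -normrN -sinN -(normrN x) hw ?oppr_ge0.
have [c _] := sin_MVT x0; rewrite sin0 !subr0 => ->.
by rewrite normrM ler_piMl // cos_max.
Qed.

(* Comparing the slopes of the chords of the sine over [0, x] and [x, pi/2]. *)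
Lemma sin_ge_chord (R : realType) (x : R) :
  0 <= x <= pi / 2 -> 2 / pi * x <= sin x.
Proof.
case/andP=> x0 xpi; have pi0 := @pi_gt0 R.
have [c /andP[c0 cx] eq1] := sin_MVT x0.
have [d /andP[xd dpi] eq2] := sin_MVT xpi.
rewrite sin0 !subr0 in eq1; rewrite sin_pihalf in eq2.
have le_cos : cos d <= cos c.
  have [->|cd] := eqVneq c d; first by [].
  have lt_cd : c < d by rewrite lt_neqAle cd (le_trans cx xd).
  by apply/ltW; rewrite ltr_cos // in_itv /=; apply/andP; split; lra.
(* The slope comparison gives (1 - sin x) x <= sin x (pi/2 - x), in which the products x sin x
   cancel. *)
have key : x <= cos c * x * (pi / 2).
  have : cos d * (pi / 2 - x) * x <= cos c * (pi / 2 - x) * x.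
    by rewrite !ler_wpM2r // subr_ge0.
  by rewrite -eq2 eq1; lra.
rewrite eq1 mulrAC ler_pdivrMr //; lra.
Qed.

(** * The Euclidean norm on complex vectors *)

Lemma normc_ge0 (R : rcfType) (z : R[i]) : 0 <= normc z.
Proof. by case: z => a b; rewrite sqrtr_ge0. Qed.

Lemma sqr_normc_conj (R : rcfType) (z : R[i]) :
  (normc z ^+ 2)%:C%C = z^* * z.
Proof. by rewrite rmorphXn /= mulrC; exact: sqr_normc. Qed.

(** By Lagrange's identity, the double sum of the squares (a_i b_j - a_j b_i)^2 is twice the right
    side minus the left. *)
Lemma cauchy_schwarz_sum (R : realFieldType) (I : finType) (a b : I -> R) :
  (\sum_i a i * b i) ^+ 2 <= (\sum_i a i ^+ 2) * (\sum_i b i ^+ 2).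
Proof.
have sqrB_cross i j : (a i * b j - a j * b i) ^+ 2 =
    a i ^+ 2 * b j ^+ 2 + b i ^+ 2 * a j ^+ 2 - (a i * b i) * (a j * b j) *+ 2.
  by rewrite mulr2n; ring.
have : 0 <= \sum_i \sum_j (a i * b j - a j * b i) ^+ 2.
  by apply: sumr_ge0 => i _; apply: sumr_ge0 => j _; rewrite sqr_ge0.
under eq_bigr => i _ do under eq_bigr => j _ do rewrite sqrB_cross.
under eq_bigr => i _ do
  rewrite sumrB big_split /= -!mulr_sumr sumrMnl -mulr_sumr.
rewrite sumrB big_split /= sumrMnl -!mulr_suml.
rewrite [X in _ + X - _]mulrC -mulr2n -mulrnBl pmulrn_lge0 // subr_ge0.
by rewrite expr2.
Qed.

Lemma l2norm_ge0 (R : realType) d (v : 'cV[R[i]]_d) : 0 <= l2norm v.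
Proof. exact: sqrtr_ge0. Qed.

Lemma sqr_l2norm (R : realType) d (v : 'cV[R[i]]_d) :
  l2norm v ^+ 2 = \sum_i normc (v i 0) ^+ 2.
Proof. by rewrite sqr_sqrtr // sumr_ge0 // => i _; rewrite sqr_ge0. Qed.

Lemma normc_le_l2norm (R : realType) d (v : 'cV[R[i]]_d) i :
  normc (v i 0) <= l2norm v.
Proof.
rewrite -ler_sqr ?nnegrE ?normc_ge0 ?l2norm_ge0 // sqr_l2norm.
by rewrite (bigD1 i) //= lerDl sumr_ge0 // => j _; rewrite sqr_ge0.
Qed.

Lemma l2norm0 (R : realType) d : l2norm (0 : 'cV[R[i]]_d) = 0.
Proof.
by rewrite /l2norm big1 ?sqrtr0 // => i _; rewrite mxE normc0 expr0n.
Qed.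

Lemma l2normN (R : realType) d (v : 'cV[R[i]]_d) : l2norm (- v) = l2norm v.
Proof. by congr Num.sqrt; apply: eq_bigr => i _; rewrite mxE normcN. Qed.

Lemma ler_l2normD (R : realType) d (u v : 'cV[R[i]]_d) :
  l2norm (u + v) <= l2norm u + l2norm v.
Proof.
rewrite -ler_sqr ?nnegrE ?addr_ge0 ?l2norm_ge0 // sqrrD !sqr_l2norm.
pose p i := normc (u i 0); pose q i := normc (v i 0).
have cs : \sum_i p i * q i <= l2norm u * l2norm v.
  apply: le_trans (ler_norm _) _.
  rewrite -ler_sqr ?nnegrE ?mulr_ge0 ?l2norm_ge0 // real_normK ?num_real //.
  by rewrite exprMn !sqr_l2norm cauchy_schwarz_sum.
apply: (@le_trans _ _ (\sum_i (p i + q i) ^+ 2)).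
  apply: ler_sum => i _; rewrite mxE ler_sqr ?nnegrE ?addr_ge0 ?normc_ge0 //.
  exact: le_normcD.
under eq_bigr => i _ do rewrite sqrrD.
by rewrite !big_split /= lerD2r lerD2l mulr2n lerD.
Qed.

Lemma ler_l2normB (R : realType) d (u v : 'cV[R[i]]_d) :
  l2norm (u - v) <= l2norm u + l2norm v.
Proof. by rewrite -(l2normN v) ler_l2normD. Qed.

(** * Reflections and the operator norm *)

Lemma hermsymmx_conj (R : realType) d (A : 'M[R[i]]_d) :
  A \is hermsymmx -> A = map_mx Num.conj A^T.
Proof. by move/is_hermitianmxP; rewrite expr0 scale1r. Qed.

Lemma sqr_l2norm_conj (R : realType) d (v : 'cV[R[i]]_d) :
  (l2norm v ^+ 2)%:C%C = (map_mx Num.conj v^T *m v) 0 0.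
Proof.
rewrite sqr_l2norm rmorph_sum mxE; apply: eq_bigr => i _.
by rewrite !mxE; exact: sqr_normc_conj.
Qed.

(** A reflection is unitary: its adjoint times itself is A^2 = 1. *)
Lemma reflection_isometry (R : realType) d (A : 'M[R[i]]_d) v :
  is_reflection A -> l2norm (A *m v) = l2norm v.
Proof.
case=> /hermsymmx_conj hA sqA.
apply/eqP; rewrite -(@eqrXn2 _ 2) ?l2norm_ge0 //; apply/eqP.
apply: (@complexI R); rewrite !sqr_l2norm_conj.
by rewrite trmx_mul map_mxM /= -hA -mulmxA (mulmxA A) sqA mul1mx.
Qed.

Lemma opnorm_le (R : realType) d (A : 'M[R[i]]_d) (K : R) :
  (forall v, l2norm v <= 1 -> l2norm (A *m v) <= K) -> opnorm A <= K.
Proof.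
move=> leK; apply: ge_sup => [|_ [v /= v1 <-]]; last exact: leK.
by exists (l2norm (A *m 0)), 0 => //=; rewrite l2norm0.
Qed.

(** The bound K certifies that the set in [opnorm] is bounded above, so that its [sup] is indeed an
    upper bound. *)
Lemma l2norm_le_opnorm (R : realType) d (A : 'M[R[i]]_d) (K : R) v :
  (forall v, l2norm v <= 1 -> l2norm (A *m v) <= K) ->
  l2norm v <= 1 -> l2norm (A *m v) <= opnorm A.
Proof.
move=> leK v1; apply: ub_le_sup; last by exists v.
by exists K => _ [w /= w1 <-]; exact: leK.
Qed.

Lemma reflection_diff_le (R : realType) d (A B : 'M[R[i]]_d) v :
  is_reflection A -> is_reflection B -> l2norm v <= 1 ->
  l2norm (A *m v - B *m v) <= opnorm (A - B).
Proof.
move=> hA hB v1; rewrite -mulmxBl.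
(* Each of the two isometries contributes at most 1 to the bound 2. *)
apply: (l2norm_le_opnorm (K := 2)) => // w w1.
rewrite mulmxBl (le_trans (ler_l2normB _ _)) // !reflection_isometry //; lra.
Qed.

(** * Ordered products of reflections *)

Lemma l2norm_foldr (R : realType) d (I : Type) (A : I -> 'M[R[i]]_d) s v :
  (forall k, is_reflection (A k)) ->
  l2norm (foldr (fun k => mulmx (A k)) v s) = l2norm v.
Proof. by move=> hA; elim: s => //= k s IH; rewrite reflection_isometry. Qed.

(** Induction on A x - B y = A (x - y) + (A - B) y: the isometry A keeps the error so far, and y has
    the norm of v, so each factor adds at most delta. *)
Lemma telescope_foldr (R : realType) d (I : Type) (A B : I -> 'M[R[i]]_d)
    (delta : R) s v :
  (forall k, is_reflection (A k)) -> (forall k, is_reflection (B k)) ->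
  (forall k, opnorm (A k - B k) <= delta) -> l2norm v <= 1 ->
  l2norm (foldr (fun k => mulmx (A k)) v s - foldr (fun k => mulmx (B k)) v s)
    <= (size s)%:R * delta.
Proof.
move=> hA hB hAB v1; elim: s => [|k s IH] /=.
  by rewrite subrr l2norm0 mul0r.
set x := foldr _ _ _ in IH *; set y := foldr _ _ _ in IH *.
rewrite -(subrK (A k *m y) (A k *m x)) -addrA -mulmxBr.
rewrite (le_trans (ler_l2normD _ _)) // reflection_isometry //.
rewrite -nat1r mulrDl mul1r.
rewrite [leRHS]addrC lerD //; apply: le_trans (hAB k).
by apply: reflection_diff_le; rewrite ?l2norm_foldr.
Qed.

Lemma foldr_mulmx (R : realType) d p (I : Type) (A : I -> 'M[R[i]]_d) s
    (v : 'M_(d, p)) :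
  foldr (fun k => mulmx (A k)) v s =
  foldr (fun k => mulmx (A k)) 1%:M s *m v.
Proof. by elim: s => [|k s /= ->]; rewrite ?mul1mx ?mulmxA. Qed.

Lemma foldr_mulmx_comm (R : realType) d p (I : Type) (A : I -> 'M[R[i]]_d) s t
    (v : 'M_(d, p)) :
  (forall j k, A j *m A k = A k *m A j) ->
  foldr (fun k => mulmx (A k)) v (s ++ t) =
  foldr (fun k => mulmx (A k)) v (t ++ s).
Proof.
move=> AC.
(* A single factor moves through a whole product; the factors of s are moved past t in this way one
   by one. *)
have comm1 (M : 'M_d) j r : A j *m M = M *m A j ->
    foldr (fun k => mulmx (A k)) M (j :: r) =
    foldr (fun k => mulmx (A k)) M r *m A j.
  by move=> jM; elim: r => //= k r IH; rewrite -mulmxA -IH !mulmxA AC.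
suff -> : foldr (fun k => mulmx (A k)) v (s ++ t) =
          foldr (fun k => mulmx (A k)) 1%:M t *m
          (foldr (fun k => mulmx (A k)) 1%:M s *m v).
  by rewrite foldr_cat -!foldr_mulmx.
elim: s => [|j s IH] /=; first by rewrite mul1mx -foldr_mulmx.
rewrite IH !mulmxA; congr (_ *m _ *m _).
by rewrite -comm1 // mul1mx mulmx1.
Qed.

(** Both orders of the A product are compared with one and the same B product, hence the factor
    2. *)
Lemma swap_le_distance (R : realType) d (I : Type) (A B : I -> 'M[R[i]]_d)
    (delta : R) s t v :
  (forall k, is_reflection (A k)) -> (forall k, is_reflection (B k)) ->
  (forall k, opnorm (A k - B k) <= delta) ->
  (forall j k, B j *m B k = B k *m B j) -> l2norm v <= 1 ->
  l2norm (foldr (fun k => mulmx (A k)) v (s ++ t) -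
          foldr (fun k => mulmx (A k)) v (t ++ s))
    <= 2 * (size s + size t)%:R * delta.
Proof.
move=> hA hB hAB BC v1.
have st := telescope_foldr (s ++ t) hA hB hAB v1.
have ts := telescope_foldr (t ++ s) hA hB hAB v1.
rewrite -(foldr_mulmx_comm s t v BC) -l2normN opprB size_cat addnC in ts.
rewrite size_cat in st.
rewrite -(subrK (foldr (fun k => mulmx (B k)) v (s ++ t))
  (foldr (fun k => mulmx (A k)) v (s ++ t))) -addrA.
rewrite (le_trans (ler_l2normD _ _)) //; lra.
Qed.

(** * Unit complex numbers exp(i t) *)

Definition cis (R : realType) (t : R) : R[i] := (cos t +i* sin t)%C.

Lemma cis0 (R : realType) : cis (0 : R) = 1.
Proof. by rewrite /cis cos0 sin0. Qed.

Lemma cisD (R : realType) (s t : R) : cis (s + t) = cis s * cis t.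
Proof.
by apply/eqP; rewrite eq_complex /= cosD eqxx sinD addrC eqxx.
Qed.

Lemma cisN (R : realType) (t : R) : cis (- t) = (cis t)^*.
Proof. by rewrite /cis sinN cosN. Qed.

(** The squared chord is 2 - 2 cos(s - t) = 4 sin^2((s - t)/2). *)
Lemma normc_cisB (R : realType) (s t : R) :
  normc (cis s - cis t) = 2 * `|sin ((s - t) / 2)|.
Proof.
have sq : (cos s - cos t) ^+ 2 + (sin s - sin t) ^+ 2 =
    (2 * sin ((s - t) / 2)) ^+ 2.
  set u := (s - t) / 2.
  have eq_u : s - t = u + u by rewrite /u; lra.
  have := cosB s t; rewrite {1}eq_u cosD.
  have := cos2Dsin2 s; have := cos2Dsin2 t; have := cos2Dsin2 u.
  move: (cos s) (cos t) (sin s) (sin t) (cos u) (sin u) => a b c d e f.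
  rewrite !expr2; lra.
by rewrite /= sq sqrtr_sqr normrM ger0_norm.
Qed.

Lemma normc_cisB_le (R : realType) (s t : R) :
  normc (cis s - cis t) <= `|s - t|.
Proof.
rewrite normc_cisB; have := ler_norm_sin ((s - t) / 2).
by rewrite normrM [`|2^-1|]ger0_norm //; lra.
Qed.

(** * Bit strings as basis labels, and monomial operators *)

Lemma card_bits m : #|{ffun 'I_m -> bool}| = (2 ^ m)%N.
Proof. by rewrite card_ffun card_bool card_ord. Qed.

Definition bits m (x : 'I_(2 ^ m)) : {ffun 'I_m -> bool} :=
  enum_val (cast_ord (esym (card_bits m)) x).

Definition unbits m (b : {ffun 'I_m -> bool}) : 'I_(2 ^ m) :=
  cast_ord (card_bits m) (enum_rank b).

Lemma bitsK m : cancel (@bits m) (@unbits m).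
Proof. by move=> x; rewrite /unbits enum_valK cast_ordKV. Qed.

Lemma unbitsK m : cancel (@unbits m) (@bits m).
Proof. by move=> b; rewrite /bits cast_ordK enum_rankK. Qed.

(* The operator v |-> (b |-> c b * v (f b)) on functions of the bit string b. *)
Definition monomial (R : realType) m (c : {ffun 'I_m -> bool} -> R[i])
    (f : {ffun 'I_m -> bool} -> {ffun 'I_m -> bool}) : 'M[R[i]]_(2 ^ m) :=
  \matrix_(x, y) (c (bits x) * (bits y == f (bits x))%:R).

Lemma monomial_mulmx (R : realType) m p c f (v : 'M[R[i]]_(2 ^ m, p)) x y :
  (monomial c f *m v) x y = c (bits x) * v (unbits (f (bits x))) y.
Proof.
rewrite mxE (bigD1 (unbits (f (bits x)))) //= mxE unbitsK eqxx mulr1.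
rewrite big1 ?addr0 // => z; rewrite mxE [bits z == _]eq_sym.
case: (f (bits x) =P bits z) => [->|_ _]; first by rewrite bitsK eqxx.
by rewrite mulr0 mul0r.
Qed.

Lemma monomialM (R : realType) m (c d : _ -> R[i]) f g :
  monomial (m := m) c f *m monomial d g =
  monomial (fun b => c b * d (f b)) (g \o f).
Proof.
by apply/matrixP => x y; rewrite monomial_mulmx !mxE unbitsK mulrA.
Qed.

(** An injective f permutes the finite basis, so only the coefficients can change the norm. *)
Lemma l2norm_monomial_le (R : realType) m (c : _ -> R[i]) f (K : R) v :
  injective f -> (forall b, normc (c b) <= K) ->
  l2norm (monomial (m := m) c f *m v) <= K * l2norm v.
Proof.
move=> injf cK; pose b0 : {ffun 'I_m -> bool} := [ffun => false].
have K0 : 0 <= K := le_trans (normc_ge0 _) (cK b0).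
rewrite -ler_sqr ?nnegrE ?mulr_ge0 ?l2norm_ge0 // exprMn !sqr_l2norm mulr_sumr.
have inj_uf : injective (fun x : 'I_(2 ^ m) => unbits (f (bits x))).
  by move=> x y /(can_inj (@unbitsK m))/injf/(can_inj (@bitsK m)).
rewrite [leRHS](reindex_inj inj_uf); apply: ler_sum => x _.
rewrite monomial_mulmx normcM exprMn ler_wpM2r ?sqr_ge0 //.
by rewrite ler_sqr ?nnegrE ?normc_ge0.
Qed.

(** Meant for commutators: both orders of a product permute the basis alike and differ in their
    coefficients only. *)
Lemma opnorm_monomialB_le (R : realType) m (c d : _ -> R[i]) f g (K : R) :
  f =1 g -> injective f -> (forall b, normc (c b - d b) <= K) ->
  opnorm (monomial (m := m) c f - monomial d g) <= K.
Proof.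
move=> fg injf cdK; pose b0 : {ffun 'I_m -> bool} := [ffun => false].
have K0 : 0 <= K := le_trans (normc_ge0 _) (cdK b0).
have -> : monomial c f - monomial d g = monomial (fun b => c b - d b) f.
  by apply/matrixP => x y; rewrite !mxE fg mulrBl.
apply: opnorm_le => v v1; apply: le_trans (l2norm_monomial_le _ injf cdK) _.
by rewrite ler_piMr.
Qed.

(** The first condition on c gives Hermitian symmetry, the second gives square 1. *)
Lemma monomial_reflection (R : realType) m (c : _ -> R[i]) f :
  involutive f -> (forall b, c (f b) = (c b)^*) ->
  (forall b, c b * c (f b) = 1) -> is_reflection (monomial (m := m) c f).
Proof.
move=> ff cf cc; split; last first.
  rewrite monomialM; apply/matrixP => x y; rewrite !mxE /= cc mul1r ff.
  by rewrite (can_eq (@bitsK m)) eq_sym.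
apply/is_hermitianmxP; rewrite expr0 scale1r; apply/matrixP => x y.
rewrite !mxE rmorphM /= conjC_nat -cf.
have -> : (bits x == f (bits y)) = (bits y == f (bits x)).
  by apply/eqP/eqP => ->; rewrite ff.
by case: eqP => [->|_]; rewrite ?ff ?mulr0.
Qed.

(** * The almost commuting qubits *)

Definition flip m (k : 'I_m) (b : {ffun 'I_m -> bool}) : {ffun 'I_m -> bool} :=
  [ffun j => b j (+) (j == k)].

Lemma flipK m (k : 'I_m) : involutive (flip k).
Proof. by move=> b; apply/ffunP => j; rewrite !ffunE addbK. Qed.

Lemma flipC m (j k : 'I_m) b : flip j (flip k b) = flip k (flip j b).
Proof. by apply/ffunP => i; rewrite !ffunE addbAC. Qed.

(** The eigenvalue of Z_k on the basis vector b. *)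
Definition sgnb (R : realType) m (k : 'I_m) (b : {ffun 'I_m -> bool}) : R :=
  (-1) ^+ b k.

Lemma sgnb_flip (R : realType) m (j k : 'I_m) b :
  sgnb R k (flip j b) = if k == j then - sgnb R k b else sgnb R k b.
Proof.
rewrite /sgnb ffunE; case: eqP => _; last by rewrite addbF.
by rewrite signr_addb mulrN1.
Qed.

Lemma normr_sgnb (R : realType) m (k : 'I_m) b : `|sgnb R k b| = 1.
Proof. by rewrite /sgnb normr_sign. Qed.

(** The eigenvalue of sum_(i < n) Z_i on the basis vector b. *)
Definition first_sum (R : realType) m n (b : {ffun 'I_m -> bool}) : R :=
  \sum_(i < m | (i < n)%N) sgnb R i b.

Lemma first_sum_flip (R : realType) m n (j : 'I_m) b :
  first_sum R n (flip j b) =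
  first_sum R n b - (if (j < n)%N then 2 * sgnb R j b else 0).
Proof.
have eq_off : \sum_(i < m | (i < n)%N && (i != j)) sgnb R i (flip j b) =
              \sum_(i < m | (i < n)%N && (i != j)) sgnb R i b.
  by apply: eq_bigr => i /andP[_ /negbTE ij]; rewrite sgnb_flip ij.
rewrite /first_sum; case: ifP => jn.
  by rewrite (bigD1 j) // eq_off [in RHS](bigD1 j) //= sgnb_flip eqxx; lra.
rewrite subr0; apply: eq_bigr => i i_n; rewrite sgnb_flip.
by case: eqP i_n => // ->; rewrite jn.
Qed.

(* The phases that conjugation of X_k, n <= k, by the diagonal unitary
   exp(i (a/2) sum_(i < n <= j) Z_i Z_j) puts on the bit flip of k. *)
Definition theta (R : realType) m n (a : R) (k : 'I_m) b : R :=
  if (k < n)%N then 0 else a * sgnb R k b * first_sum R n b.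

Definition theta_jump (R : realType) m n (a : R) (j k : 'I_m) b : R :=
  if (j < n <= k)%N then 2 * a * sgnb R k b * sgnb R j b else 0.

(** For n <= k the flip negates the sign of bit k and leaves [first_sum] alone. This oddness makes
    [opX] a reflection. *)
Lemma theta_flip_eq (R : realType) m n (a : R) (k : 'I_m) b :
  theta n a k (flip k b) = - theta n a k b.
Proof.
rewrite /theta; case: ifP => kn; first by rewrite oppr0.
by rewrite sgnb_flip eqxx first_sum_flip kn; lra.
Qed.

Lemma theta_flip_neq (R : realType) m n (a : R) (j k : 'I_m) b : j != k ->
  theta n a k (flip j b) = theta n a k b - theta_jump n a j k b.
Proof.
rewrite eq_sym /theta /theta_jump => /negbTE jk.
rewrite sgnb_flip jk first_sum_flip [(n <= k)%N]leqNgt.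
by case: (k < n)%N; case: (j < n)%N => /=; lra.
Qed.

Definition opX (R : realType) m n (a : R) (k : 'I_m) : 'M[R[i]]_(2 ^ m) :=
  monomial (fun b => cis (theta n a k b)) (flip k).

Definition opZ (R : realType) m (k : 'I_m) : 'M[R[i]]_(2 ^ m) :=
  monomial (fun b => (sgnb R k b)%:C%C) id.

Lemma opX_reflection (R : realType) m n (a : R) (k : 'I_m) :
  is_reflection (opX n a k).
Proof.
apply: monomial_reflection; first exact: flipK.
  by move=> b; rewrite theta_flip_eq cisN.
by move=> b; rewrite theta_flip_eq -cisD subrr cis0.
Qed.

Lemma opZ_reflection (R : realType) m (k : 'I_m) :
  is_reflection (opZ R k).
Proof.
apply: monomial_reflection => // b; first exact/esym/conjc_real.
by rewrite -rmorphM /= /sgnb -expr2 sqrr_sign.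
Qed.

Lemma opXZ_anticommute (R : realType) m n (a : R) (k : 'I_m) :
  opX n a k *m opZ R k + opZ R k *m opX n a k = 0.
Proof.
rewrite !monomialM; apply/matrixP => x y; rewrite !mxE /= sgnb_flip eqxx.
by rewrite rmorphN /=; ring.
Qed.

(** At most one of the two jumps is nonzero, as j < n <= k and k < n <= j exclude each other. *)
Lemma theta_jumpB_le (R : realType) m n (a : R) (j k : 'I_m) b : 0 <= a ->
  `|theta_jump n a j k b - theta_jump n a k j b| <= 2 * a.
Proof.
move=> a0; have bound i l : `|2 * a * sgnb R i b * sgnb R l b| <= 2 * a.
  by rewrite !normrM !normr_sgnb !mulr1 !ger0_norm.
rewrite /theta_jump; case: ifP => [/andP[jn nk]|_].
  by rewrite ifF ?subr0 ?bound // [(k < n)%N]ltnNge nk.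
by case: ifP => _; rewrite ?subrr ?normr0 ?mulr_ge0 // sub0r normrN.
Qed.

Definition qubit_of (R : realType) m n (a : R) (k : 'I_m) : qubit R (2 ^ m) :=
  Qubit (opX_reflection n a k) (opZ_reflection R k) (opXZ_anticommute n a k).

Lemma commutator_le (R : realType) m n (a : R) (j k : 'I_m) S T :
  0 <= a -> j != k ->
  opnorm (commutator (qubit_op S (qubit_of n a j))
                     (qubit_op T (qubit_of n a k))) <= 2 * a.
Proof.
move=> a0 jk; have kj : k != j by rewrite eq_sym.
have a20 : 0 <= 2 * a by rewrite mulr_ge0.
have injflip i : injective (@flip m i) := can_inj (@flipK m i).
rewrite /commutator; case: S; case: T; rewrite /= !monomialM.
- apply: opnorm_monomialB_le => [b|| b]; [exact: flipC | exact: inj_comp |].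
  (* The total phases of X_j X_k and X_k X_j differ by the two jumps alone. *)
  rewrite -!cisD; apply: le_trans (normc_cisB_le _ _) _.
  rewrite !theta_flip_neq // (_ : _ - _ =
    theta_jump n a k j b - theta_jump n a j k b); last by ring.
  exact: theta_jumpB_le.
(* From here on the commutators vanish: flipping one bit keeps the sign of another, and diagonal
   operators commute. *)
- apply: opnorm_monomialB_le => [//|| b]; first exact: injflip.
  by rewrite sgnb_flip (negbTE kj) mulrC subrr normc0.
- apply: opnorm_monomialB_le => [//|| b]; first exact: injflip.
  by rewrite sgnb_flip (negbTE jk) mulrC subrr normc0.
- apply: opnorm_monomialB_le => [//|//| b].
  by rewrite mulrC subrr normc0.
Qed.

(** * Phases accumulated by products of the X_k *)

Fixpoint phase (R : realType) m n (a : R) (s : seq 'I_m)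
    (b : {ffun 'I_m -> bool}) : R :=
  if s is k :: s' then theta n a k b + phase n a s' (flip k b) else 0.

Definition flips m (s : seq 'I_m) (b : {ffun 'I_m -> bool}) :=
  foldl (fun b k => flip k b) b s.

Lemma flipsE m (s : seq 'I_m) (b : {ffun 'I_m -> bool}) : uniq s ->
  flips s b = [ffun j => b j (+) (j \in s)].
Proof.
rewrite /flips; elim: s b => [|k s IH] b /=.
  by move=> _; apply/ffunP => j; rewrite ffunE addbF.
case/andP=> ks us; rewrite IH //; apply/ffunP => j; rewrite !ffunE in_cons.
rewrite -addbA; congr addb.
by case: eqP => // ->; rewrite (negbTE ks).
Qed.

(** Each factor reads its phase at the bit string already flipped by the factors to its left, as in
    the recursion of [phase]. *)
Lemma foldr_opX (R : realType) m n (a : R) (s : seq 'I_m)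
    (v : 'cV[R[i]]_(2 ^ m)) x y :
  foldr (fun k => mulmx (opX n a k)) v s x y =
  cis (phase n a s (bits x)) * v (unbits (flips s (bits x))) y.
Proof.
elim: s x => [|k s IH] x /=; first by rewrite cis0 mul1r bitsK.
by rewrite monomial_mulmx IH unbitsK cisD mulrA.
Qed.

Lemma phase_cat (R : realType) m n (a : R) (s t : seq 'I_m)
    (b : {ffun 'I_m -> bool}) :
  phase n a (s ++ t) b = phase n a s b + phase n a t (flips s b).
Proof. by elim: s b => [|k s IH] b /=; rewrite ?add0r // IH addrA. Qed.

Lemma phase_first (R : realType) m n (a : R) (s : seq 'I_m)
    (b : {ffun 'I_m -> bool}) :
  {in s, forall k : 'I_m, (k < n)%N} -> phase n a s b = 0.
Proof.
elim: s b => [//|k s IH] b sn /=.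
rewrite /theta sn ?mem_head // add0r IH // => j js.
by rewrite sn // in_cons js orbT.
Qed.

(** All factors contribute equally: flips at positions from n on preserve [first_sum], and without
    repetitions each bit is still false when its own factor is reached. *)
Lemma phase_last (R : realType) m n (a : R) (s : seq 'I_m)
    (b : {ffun 'I_m -> bool}) :
  uniq s -> {in s, forall k : 'I_m, (n <= k)%N} ->
  {in s, forall k, b k = false} ->
  phase n a s b = (size s)%:R * (a * first_sum R n b).
Proof.
elim: s b => [|k s IH] b /=; first by rewrite mul0r.
case/andP=> ks us sn sb.
have kn : (k < n)%N = false by rewrite ltnNge sn ?mem_head.
rewrite /theta kn IH //; first last.
- move=> j js; rewrite ffunE sb ?in_cons ?js ?orbT //=.
  by apply: contraNF ks => /eqP <-.
- by move=> j js; rewrite sn // in_cons js orbT.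
by rewrite first_sum_flip kn subr0 /sgnb sb ?mem_head // -nat1r; ring.
Qed.

Lemma l2norm_delta (R : realType) d (i : 'I_d) :
  l2norm (delta_mx i 0 : 'cV[R[i]]_d) = 1.
Proof.
rewrite /l2norm (bigD1 i) //= big1 => [|j /negbTE ji].
  by rewrite mxE !eqxx normc1 expr1n addr0 sqrtr1.
by rewrite mxE ji normc0 expr0n.
Qed.

(** * The two halves of the indices and the lower bound *)

Definition low_ord m n : seq 'I_m := [seq k : 'I_m <- enum 'I_m | (k < n)%N].

Definition high_ord m n : seq 'I_m := [seq k : 'I_m <- enum 'I_m | (n <= k)%N].

Lemma size_low_ord m n : (n <= m)%N -> size (low_ord m n) = n.
Proof.
move=> nm; rewrite -sum1_size big_filter big_enum_cond /=.
by rewrite -(big_ord_widen m (fun=> 1%N)) // sum1_card card_ord.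
Qed.

Lemma size_high_ord m n : (n <= m)%N -> size (high_ord m n) = (m - n)%N.
Proof.
move=> nm; have := count_predC (fun k : 'I_m => (k < n)%N) (enum 'I_m).
rewrite size_enum_ord -!size_filter -/(low_ord m n) size_low_ord //.
move/(canRL (addKn n)) <-; congr size.
by apply: eq_filter => k /=; rewrite leqNgt.
Qed.

Lemma first_sum_const (R : realType) m n (c : bool) (b : {ffun 'I_m -> bool}) :
  (n <= m)%N -> (forall k : 'I_m, (k < n)%N -> b k = c) ->
  first_sum R n b = (-1) ^+ c * n%:R.
Proof.
move=> nm bc; rewrite /first_sum.
under eq_bigr => i i_n do rewrite /sgnb bc //.
rewrite -(big_ord_widen m (fun=> (-1) ^+ c : R)) // sumr_const card_ord.
by rewrite mulr_natr.
Qed.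

Lemma swap_ge_sin (R : realType) m n (a : R) : (n <= m)%N ->
  let s := low_ord m n in let t := high_ord m n in
  exists2 v : 'cV[R[i]]_(2 ^ m), l2norm v = 1 &
    2 * `|sin (((m - n) * n)%:R * a)| <=
    l2norm (foldr (fun k => mulmx (opX n a k)) v (s ++ t) -
            foldr (fun k => mulmx (opX n a k)) v (t ++ s)).
Proof.
move=> nm s t; pose b0 : {ffun 'I_m -> bool} := [ffun => false].
have us : uniq s by rewrite filter_uniq ?enum_uniq.
have ut : uniq t by rewrite filter_uniq ?enum_uniq.
have sn : {in s, forall k : 'I_m, (k < n)%N}.
  by move=> k; rewrite mem_filter => /andP[].
have tn : {in t, forall k : 'I_m, (n <= k)%N}.
  by move=> k; rewrite mem_filter => /andP[].
have flips_eq : flips (t ++ s) b0 = flips (s ++ t) b0.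
  have ust : uniq (s ++ t).
    rewrite cat_uniq us ut andbT; apply/hasPn => k /tn nk.
    by apply/negP => /sn; rewrite ltnNge nk.
  rewrite !flipsE ?(uniq_catC t) //.
  by apply/ffunP => j; rewrite !ffunE !mem_cat orbC.
(* Here the factors of t act after the low bits became true, so [first_sum] is -n; in the other
   order it is still n. *)
have phase_st : phase n a (s ++ t) b0 = - (((m - n) * n)%:R * a).
  rewrite phase_cat phase_first // add0r phase_last //; last first.
    move=> k /tn nk; rewrite flipsE // !ffunE /=.
    by apply/negP => /sn; rewrite ltnNge nk.
  rewrite (first_sum_const _ (c := true)) // => [|k kn].
    by rewrite size_high_ord // natrM; ring.
  by rewrite flipsE // !ffunE mem_filter kn mem_enum.
have phase_ts : phase n a (t ++ s) b0 = ((m - n) * n)%:R * a.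
  rewrite phase_cat (phase_first _ _ sn) addr0 phase_last //; last first.
    by move=> k _; rewrite ffunE.
  rewrite (first_sum_const _ (c := false)) // => [|k _]; last by rewrite ffunE.
  by rewrite size_high_ord // natrM; ring.
(* Both products send this basis vector to a phase times the one labelled [b0], so that coordinate
   shows the whole gap. *)
exists (delta_mx (unbits (flips (s ++ t) b0)) 0); first exact: l2norm_delta.
apply: le_trans (normc_le_l2norm _ (unbits b0)).
rewrite !mxE !foldr_opX !unbitsK flips_eq mxE !eqxx !mulr1 phase_st phase_ts.
rewrite normc_cisB (_ : _ / 2 = - (((m - n) * n)%:R * a)); last by lra.
by rewrite sinN normrN.
Qed.

(** * Comparison with independent qubits *)

Lemma opnorm_le_max_distance (R : realType) d m (q q' : 'I_m -> qubit R d)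
    S (k : 'I_m) :
  opnorm (qubit_op S (q k) - qubit_op S (q' k)) <= max_distance q q'.
Proof.
apply: le_trans (le_bigmax _ _ k); rewrite le_max; apply/orP.
by case: S; [left | right]; exact: lexx.
Qed.

Unset Implicit Arguments.

Theorem lemma3p9 (R : realType) (n : nat) (eps : R) :
  (1 <= n)%N ->
  0 <= eps <= pi / n%:R ^+ 2 ->
  exists q : 'I_(2 * n) -> qubit R (2 ^ (2 * n)),
    (forall i j : 'I_(2 * n), i != j -> forall S T : axis,
       opnorm (commutator (qubit_op S (q i)) (qubit_op T (q j))) <= eps) /\
    (forall q' : 'I_(2 * n) -> qubit R (2 ^ (2 * n)),
       independent q' ->
       n%:R * eps / (2 * pi) <= max_distance q q').
Proof.
move=> n_ge1 /andP[eps0 eps_le].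
(* The commutator bound is 2a, whence a = eps/2. *)
exists (qubit_of n (eps / 2)); split=> [i j ij S T | q' indep].
  have := commutator_le n S T (divr_ge0 eps0 (ler0n _ 2)) ij.
  by rewrite [2 * _]mulrC divfK ?pnatr_eq0.
have n0 : 0 < n%:R :> R by rewrite ltr0n.
have n_le : (n <= 2 * n)%N by rewrite leq_pmull.
have [v v1 ge_sin] := swap_ge_sin (eps / 2) n_le.
set q := qubit_of n (eps / 2).
have le_dist := swap_le_distance (A := opX n (eps / 2))
  (B := fun k => qubitX (q' k)) (delta := max_distance q q')
  (low_ord (2 * n) n) (high_ord (2 * n) n)
  (@opX_reflection _ _ _ _) (fun k => qubitX_reflection (q' k))
  (opnorm_le_max_distance q q' axisX).
have {le_dist ge_sin} := le_trans ge_sin (le_dist v _ _).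
have m_n : (2 * n - n = n)%N by rewrite mul2n -addnn addnK.
rewrite size_low_ord // size_high_ord // m_n v1 lexx.
set x := (n * n)%:R * _ => /(_ _ isT) main.
(* Here x = n^2 eps / 2, and eps <= pi / n^2 keeps it where the chord bound on the sine applies. *)
have x_bound : 0 <= x <= pi / 2.
  have : n%:R ^+ 2 * eps <= pi by rewrite mulrC -ler_pdivlMr ?exprn_gt0.
  have : 0 <= n%:R ^+ 2 * eps by rewrite mulr_ge0 // sqr_ge0.
  by rewrite /x natrM -expr2 mulrA => ? ?; apply/andP; split; lra.
have sin_x := sin_ge_chord x_bound.
have {main} : 2 * (2 / pi * x) <= 2 * (n + n)%:R * max_distance q q'.
  apply: le_trans (main _) => [|j k]; last first.
    have [->//|jk] := eqVneq j k.
    by have /subr0_eq := indep j k jk axisX axisX.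
  by rewrite ler_pM2l // (le_trans sin_x) // ler_norm.
(* Both sides equal 2 n^2 eps / pi; the common factor 4n then cancels. *)
have -> : 2 * (2 / pi * x) = 2 * (n + n)%:R * (n%:R * eps / (2 * pi)).
  by rewrite /x natrM natrD; move: pi (lt0r_neq0 (pi_gt0 R)) => p p0; field.
by rewrite ler_pM2l // mulr_gt0 // natrD addr_gt0.
Qed.
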